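(* There exists a nonseparably connected metric space $M$ of cardinality $\mathfrak{c}$ with the following properties: (1) $M\setminus\{p\}$ is disconnected for every $p\in M$; (2) $M$ is not locally connected at any point; (3) $M$ is a topological group (i.e. there is a group operation on $M$ which together with the metric topology makes $M$ a topological group), and thus $M$ is a homogeneous space.
   Context: A topological space is called nonseparably connected if it is connected and all of its (nonempty) separable connected subsets are singletons. $\mathfrak{c}$ denotes the cardinality of the continuum. A space is homogeneous if for any two of its points there is a self-homeomorphism of the space mapping one to the other. *)

(* Defs.v *)
From HB Require Import structures.
From mathcomp Require Import all_boot all_order all_algebra.
From mathcomp Require Import all_classical all_reals all_analysis.
Set Implicit Arguments.
Unset Strict Implicit.
Unset Printing Implicit Defensive.

Local Open Scope classical_set_scope.

(* The points of D lie in A itself, so that D is a countable dense subset of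
   the subspace A (the closure of D in A is A `&` closure D). *)
Definition separable_set (T : topologicalType) (A : set T) : Prop :=
  exists D : set T, [/\ countable D, D `<=` A & A `<=` closure D].

Definition nonseparably_connected (T : topologicalType) : Prop :=
  connected [set: T] /\
  forall A : set T, A !=set0 -> separable_set A -> connected A ->
    exists x : T, A = [set x].

(* Neighborhoods need not be open: V only has to contain x in its interior. *)
Definition locally_connected_at (T : topologicalType) (x : T) : Prop :=
  forall U : set T, nbhs x U ->
    exists V : set T, [/\ nbhs x V, V `<=` U & connected V].

Definition is_group (G : Type) (mul : G -> G -> G) (one : G) (inv : G -> G) :
    Prop :=
  [/\ associative mul, left_id one mul, right_id one mul,
      left_inverse one inv mul & right_inverse one inv mul].

Definition is_topological_group (T : topologicalType) : Prop :=
  exists (mul : T -> T -> T) (one : T) (inv : T -> T),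
    [/\ is_group mul one inv,
        continuous (fun z : T * T => mul z.1 z.2) & continuous inv].

Definition homogeneous_space (T : topologicalType) : Prop :=
  forall x y : T, exists (f g : T -> T),
    [/\ cancel f g, cancel g f, continuous f, continuous g & f x = y].

(* Main.v *)
Require Import Defs.
From HB Require Import structures.
From mathcomp Require Import all_boot all_order all_algebra.
From mathcomp Require Import all_classical all_reals all_analysis.
From mathcomp Require Import ring lra zify.
Local Open Scope classical_set_scope.
Local Open Scope card_scope.

(** The space is the real line with the translation-invariant metric
    N (x - y), where N x = |x| + sup_n |f x n| and f is a discontinuous
    additive map from R to the nonseparable space of bounded real sequences.
    In other words it is the graph of f, so it is a metric group with a
    continuous bijective homomorphism to R.

    Because that bijection is continuous, connected subsets are intervals, and
    removing a point disconnects the space.  Two soft arguments then reduce the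
    remaining claims to connectedness and nonseparability of the whole space
    ([connected_nonseparable_line]).  A nondegenerate interval covers the group
    by countably many translates, so it is separable only if the whole group
    is.  If the space were locally connected at one point, small balls would
    contain nondegenerate intervals, N would be continuous at 0 for the usual
    topology, and the rationals would be dense.

    The map f is built so as to be generic ([generic_additive_function]): for
    every line p + t v of bounded sequences and every continuous g on the plane
    whose zero set projects onto some interval, there are x and t with
    g (x, t) = 0 and f x = p + t v.  Constant lines make f surjective, hence
    the graph nonseparable, by a diagonal argument.  For connectedness, suppose
    the graph splits into two separated pieces.  The difference of the distances
    to the pieces is a continuous function on the product of R with the bounded
    sequences, which does not vanish on the graph.  By connectedness of R it
    takes both signs above some u0, at p and at q say, hence also above every
    point near u0.  By the intermediate value theorem it vanishes on the segment
    from p to q above each of these points, so genericity yields a zero on the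
    graph, a contradiction ([graph_line_connected]).

    The requirements on f are all met at once, at independent points.  A
    requirement (p, v, g) is determined by countably many real numbers, since g is
    continuous, so it can be coded by an infinite binary word.  An explicit
    family of reals indexed by these words is linearly independent over Q
    ([free_real_free]).  A rational multiple of the real coded by (p, v, g) lies
    in the interval where g has zeros, and rational multiples preserve
    independence.  So the values of f at these multiples can be prescribed at
    will, one for each requirement, and Zorn's lemma extends the assignment to a
    Q-linear map on R ([linear_extension]). *)

Set Implicit Arguments.
Unset Strict Implicit.
Unset Printing Implicit Defensive.
Import Order.TTheory GRing.Theory Num.Theory.
Import numFieldNormedType.Exports.
Local Open Scope ring_scope.

(** * A family of reals, indexed by binary words, that is free over Q *)

(** Linear independence over the subfield F of the coefficients of U; the
    scalars are carried by a morphism, so that R and the space of sequences are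
    Q-vector spaces without a second module structure on them. *)
Definition free_over (F : fieldType) (K : nzRingType) (phi : {rmorphism F -> K})
    (U : lmodType K) (I : eqType) (x : I -> U) : Prop :=
  forall (s : seq I) (c : I -> F), uniq s ->
    \sum_(i <- s) phi (c i) *: x i = 0 -> forall i, i \in s -> c i = 0.

Section IndependentReals.
Variable R : realType.
Implicit Types (A : nat -> bool) (a b : nat -> bool).

Definition weight (m : nat) : R := 2 ^- (m ^ 2).

Definition partial_sum A (n : nat) : R := \sum_(m < n) (A m)%:R * weight m.

Lemma partial_sumS A n :
  partial_sum A n.+1 = partial_sum A n + (A n)%:R * weight n.
Proof. by rewrite /partial_sum big_ord_recr. Qed.

Lemma weight_gt0 m : 0 < weight m.
Proof. by rewrite /weight invr_gt0 exprn_gt0. Qed.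

Lemma weightS n : 2 * weight n.+1 <= weight n.
Proof.
rewrite /weight; have -> : (n.+1 ^ 2 = (n ^ 2 + n.*2).+1)%N by lia.
rewrite exprS invfM mulrA mulfV // mul1r exprD invfM.
rewrite ler_piMr ?invr_ge0 ?exprn_ge0 //.
by rewrite invf_le1 ?exprn_gt0 // exprn_ege1 // ler1n.
Qed.

(** The weights at least halve at each step, so a tail is at most twice its
    first weight; the subtracted term makes the bound inductive. *)
Lemma partial_sum_tail A n k :
  partial_sum A n <= partial_sum A (n + k) <=
    partial_sum A n + 2 * (weight n - weight (n + k)).
Proof.
elim: k => [|k /andP[l u]]; first by rewrite addn0; apply/andP; split; lra.
rewrite addnS partial_sumS; have := weightS (n + k); have := weight_gt0 (n + k).
by case: (A (n + k)) => /=; rewrite ?mul1r ?mul0r => ? ?;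
  apply/andP; split; lra.
Qed.

Definition binary_real A : R := sup (range (partial_sum A)).

(** The partial sums approximate the real number to within 2 * weight n, while
    their denominators only grow like those of weight n.-1.  This gap is all
    that the independence argument uses. *)
Lemma binary_real_approx A n :
  partial_sum A n <= binary_real A <= partial_sum A n + 2 * weight n.
Proof.
have ub : ubound (range (partial_sum A)) (partial_sum A n + 2 * weight n).
  move=> _ [m _ <-]; case: (leqP n m) => [nm|/ltnW mn].
    have := partial_sum_tail A n (m - n); rewrite subnKC // => /andP[_ h].
    by have := weight_gt0 m; lra.
  have := partial_sum_tail A m (n - m); rewrite subnKC // => /andP[h _].
  by have := weight_gt0 n; lra.
apply/andP; split.
  by apply: (ub_le_sup (ex_intro _ _ ub)); exists n.
by apply: ge_sup => //; exists (partial_sum A 0), 0%N.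
Qed.

Lemma weight_int m n : (m <= n)%N -> weight m * 2 ^+ (n ^ 2) \is a Num.int.
Proof.
move=> mn; have mn2 : (m ^ 2 <= n ^ 2)%N by rewrite leq_exp2r.
rewrite /weight -(subnK mn2) exprD mulrCA mulVf ?expf_neq0 //.
by rewrite mulr1 rpredX ?natr_int.
Qed.

(** The truncated combination T n.+1 is a multiple of 2 ^- (n ^ 2) but, since
    the full combination is zero, it is at most a constant times
    2 ^- (n.+1 ^ 2).  So it vanishes for large n, and the digit, being a
    difference of consecutive truncations, vanishes too. *)
Lemma eventually_zero_digits (I : eqType) (s : seq I) (A : I -> nat -> bool)
    (c : I -> int) :
  \sum_(i <- s) (c i)%:~R * binary_real (A i) = 0 ->
  exists N, forall m, (N <= m)%N -> \sum_(i <- s) (c i) * (A i m)%:R = 0.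
Proof.
move=> s0.
pose T n : R := \sum_(i <- s) (c i)%:~R * partial_sum (A i) n.
pose C : R := \sum_(i <- s) `|(c i)%:~R|.
have C0 : 0 <= C by apply: sumr_ge0.
have Tle n : `|T n| <= C * (2 * weight n).
  rewrite -[T n]subr0 -s0 -sumrB mulr_suml.
  rewrite (le_trans (ler_norm_sum _ _ _)) //.
  apply: ler_sum => i _; rewrite -mulrBr normrM ler_wpM2l //.
  have /andP[? ?] := binary_real_approx (A i) n.
  by rewrite ler_norml; apply/andP; split; lra.
have Tint n : T n.+1 * 2 ^+ (n ^ 2) \is a Num.int.
  rewrite mulr_suml rpred_sum // => i _; rewrite -mulrA rpredM ?intr_int //.
  rewrite mulr_suml rpred_sum // => m _; rewrite -mulrA rpredM ?weight_int //.
    by rewrite natr_int.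
  by rewrite -ltnS.
have [N CN] : exists N : nat, C < N%:R.
  by exists (Num.bound C); exact: archi_boundP.
have T0 n : (N <= n)%N -> T n.+1 = 0.
  move=> Nn; have p0 : 0 < 2 ^+ (n ^ 2) :> R by rewrite exprn_gt0.
  (* a nonzero integer has absolute value at least 1 *)
  apply/eqP; apply: contraT => Tn0.
  have := norm_intr_ge1 (Tint n) (mulf_neq0 Tn0 (lt0r_neq0 p0)).
  rewrite normrM (gtr0_norm p0) leNgt => /negP[].
  have w : 2 * weight n.+1 * 2 ^+ (n ^ 2) = 2 ^- n.*2.
    rewrite /weight (_ : (n.+1 ^ 2)%N = (n ^ 2 + n.*2).+1); last lia.
    rewrite exprS exprD !invfM; field.
    by rewrite !expf_neq0.
  rewrite (le_lt_trans (ler_wpM2r (ltW p0) (Tle n.+1))) // -mulrA w.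
  rewrite ltr_pdivrMr ?exprn_gt0 // mul1r (lt_le_trans CN) // -natrX ler_nat.
  rewrite (leq_trans Nn) // (leq_trans (ltnW (ltn_expl n (ltnSn 1)))) //.
  by rewrite leq_exp2l // -addnn leq_addr.
exists N.+1 => m Nm; apply/eqP; rewrite -(intr_eq0 R).
have [n En] : exists n, m = n.+1 by exists m.-1; lia.
have /eqP : T m.+1 - T m = 0 by rewrite En !T0 ?subr0 //; lia.
rewrite -sumrB.
rewrite (eq_bigr (fun i => ((c i) * (A i m)%:R)%:~R * weight m)); last first.
  move=> i _; rewrite partial_sumS -mulrBr addrC addKr mulrA.
  by rewrite rmorphM /= rmorph_nat.
by rewrite -mulr_suml mulf_eq0 (gt_eqF (weight_gt0 m)) orbF -rmorph_sum.
Qed.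

(** The codes of the finite prefixes of a word.  Two different words share only
    finitely many prefixes, so these infinite sets of naturals are almost
    disjoint. *)
Definition prefix_codes a : nat -> bool :=
  fun m => if unpickle m is Some s then s == mkseq a (size s) else false.

Lemma prefix_codes_pickle a b n :
  prefix_codes b (pickle (mkseq a n)) = (mkseq a n == mkseq b n).
Proof. by rewrite /prefix_codes pickleK size_mkseq. Qed.

Lemma pickle_prefix_unbounded a N n0 :
  exists2 n, (n0 <= n)%N & (N <= pickle (mkseq a n))%N.
Proof.
apply: contrapT => H.
have lt n : (n0 <= n)%N -> (pickle (mkseq a n) < N)%N.
  by move=> nn; rewrite ltnNge; apply/negP => ?; apply: H; exists n.
pose g (i : 'I_N.+1) : 'I_N := Ordinal (lt (n0 + i)%N (leq_addr _ _)).
suff /leq_card : injective g by rewrite !card_ord ltnn.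
move=> i j /(congr1 val) /= /(pcan_inj pickleK) /(congr1 size).
by rewrite !size_mkseq => /addnI /ord_inj.
Qed.

Lemma common_denominator (I : eqType) (s : seq I) (c : I -> rat) :
  exists (D : int) (c' : I -> int),
    D != 0 /\ forall i, i \in s -> D%:~R * c i = (c' i)%:~R.
Proof.
suff [D [D0 H]] : exists D : int, D != 0 /\
    forall i, i \in s -> D%:~R * c i \is a Num.int.
  exists D, (fun i => Num.floor (D%:~R * c i)); split=> // i /H.
  by move/floorK ->.
elim: s => [|j s [D [D0 H]]]; first by exists 1.
exists (denq (c j) * D); split; first by rewrite mulf_neq0 ?denq_neq0.
move=> i; rewrite inE rmorphM /= => /predU1P[->|/H].
  rewrite -{2}[c j]divq_num_den mulrAC mulrCA mulfV ?intr_eq0 ?denq_neq0 //.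
  by rewrite mulr1 rpredM ?intr_int.
by rewrite -mulrA; apply: rpredM; rewrite intr_int.
Qed.

Definition free_real a : R := binary_real (prefix_codes a).

(** After clearing denominators, take a prefix of the word a that is long enough
    to differ from the prefixes of all other words in s, and whose code is large
    enough for the digit at that code to vanish.  That digit is the coefficient
    of a alone. *)
Lemma free_real_free : free_over (@ratr R) (free_real : _ -> R^o).
Proof.
move=> s c us s0 a as_; have [D [c' [D0 Dc]]] := common_denominator s c.
have {}s0 : \sum_(b <- s) (c' b)%:~R * free_real b = 0.
  transitivity (D%:~R * \sum_(b <- s) ratr (c b) * free_real b); last first.
    by rewrite [X in _ * X]s0 mulr0.
  rewrite mulr_sumr big_seq [RHS]big_seq; apply: eq_bigr => b bs.
  by rewrite mulrA -(ratr_int R D) -rmorphM /= Dc // ratr_int.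
have [N sN] := eventually_zero_digits s0.
have /choice[k kP] : forall b, exists k, b != a -> mkseq a k.+1 != mkseq b k.+1.
  move=> b; apply: contrapT => H; have ab : b = a.
    apply/funext => k; apply: contrapT => bak; apply: H; exists k => _.
    apply/eqP => /(congr1 (fun s => nth false s k)).
    by rewrite !nth_mkseq // => /esym.
  by apply: H; exists 0%N; rewrite ab eqxx.
have [n kn Nn] := pickle_prefix_unbounded a N (\max_(b <- s) k b).+1.
have := sN _ Nn; rewrite (bigD1_seq a) //= prefix_codes_pickle eqxx mulr1.
rewrite big_seq_cond big1 ?addr0 => [ca|b /andP[bs ba]].
  have /eqP := Dc _ as_; rewrite ca mulf_eq0 intr_eq0 (negPf D0) /=.
  by move/eqP.
rewrite prefix_codes_pickle (_ : _ == _ = false) ?mulr0 //.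
apply: contraNF (kP _ ba) => /eqP /(congr1 (take (k b).+1)) /eqP.
have kb : (k b < n)%N by rewrite (leq_trans _ kn) // ltnS leq_bigmax_seq.
by rewrite /mkseq -!map_take take_iota (minn_idPl kb).
Qed.

End IndependentReals.

(** * Extension of linear maps from a free family *)

Section LinearExtension.
Variables (F : fieldType) (K : nzRingType) (phi : {rmorphism F -> K}).
Variables (U V : lmodType K).

Definition subspace_over (W : lmodType K) (G : set W) : Prop :=
  G 0 /\ forall a p q, G p -> G q -> G (phi a *: p + q).

(** Partial linear maps are encoded by their graphs, so that the union of a
    chain is an upper bound.  The set S constrains the values and is preserved
    by extension. *)
Record linear_graph (S : set V) (G : set (U * V)) : Prop := LinearGraph {
  graph_subspace : subspace_over G;
  graph_functional : forall v, G (0, v) -> v = 0;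
  graph_range : forall p, G p -> S p.2 }.

Lemma graph_unique S G u v w :
  linear_graph S G -> G (u, v) -> G (u, w) -> v = w.
Proof.
move=> [[_ Glin] Gfun _] Gv Gw; apply/eqP; rewrite -subr_eq0; apply/eqP/Gfun.
have := Glin (-1) _ _ Gw Gv; rewrite rmorphN1 scaleN1r.
by congr (G _); congr pair => /=; rewrite ?addNr // addrC.
Qed.

Section Span.
Variables (I : eqType) (x : I -> U) (y : I -> V).

(** Freeness of x is what makes this the graph of a partial map. *)
Definition span_graph : set (U * V) := [set p | exists s c,
  uniq s /\ p = \sum_(i <- s) phi (c i) *: ((x i, y i) : U * V)].

Lemma span_graph_subspace : subspace_over span_graph.
Proof.
split; first by exists [::], (fun=> 0); rewrite big_nil.
move=> a _ _ [s [c [us ->]]] [t [d [ut ->]]].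
have widen (r w : seq I) (h : I -> U * V) : uniq r -> uniq w ->
    {subset r <= w} -> \sum_(i <- r) h i = \sum_(i <- w | i \in r) h i.
  move=> ur uw rw; rewrite -[RHS]big_filter; apply: perm_big.
  apply: uniq_perm => //; first exact: filter_uniq.
  by move=> i; rewrite mem_filter; case: (boolP (i \in r)) => // /rw ->.
pose r := undup (s ++ t); have ur : uniq r by exact: undup_uniq.
exists r, (fun i =>
  a * (if i \in s then c i else 0) + (if i \in t then d i else 0)).
split => //; rewrite scaler_sumr (widen s r) //; last first.
  by move=> i si; rewrite mem_undup mem_cat si.
rewrite (widen t r) //; last by move=> i ti; rewrite mem_undup mem_cat ti orbT.
rewrite !(big_mkcond (fun i => i \in _)) -big_split; apply: eq_bigr => i _ /=.
rewrite rmorphD rmorphM scalerDl -scalerA.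
by congr +%R; case: ifP => _; rewrite ?rmorph0 ?scale0r ?scaler0.
Qed.

Lemma span_graphP (S : set V) : subspace_over S -> (forall i, S (y i)) ->
  free_over phi x -> linear_graph S span_graph.
Proof.
have fstE (s : seq I) c : (\sum_(i <- s) phi (c i) *: ((x i, y i) : U * V)).1 =
  \sum_(i <- s) phi (c i) *: x i.
  by rewrite (big_morph fst (id1 := 0) (op1 := +%R)).
have sndE (s : seq I) c : (\sum_(i <- s) phi (c i) *: ((x i, y i) : U * V)).2 =
  \sum_(i <- s) phi (c i) *: y i.
  by rewrite (big_morph snd (id1 := 0) (op1 := +%R)).
move=> [S0 Slin] Sy free; split; first exact: span_graph_subspace.
- move=> v [s [c [us E]]].
  have /esym s0 := congr1 fst E; rewrite fstE in s0.
  rewrite (_ : v = (0 : U, v).2) // E sndE big_seq big1 // => i si.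
  by rewrite (free _ _ us s0 _ si) rmorph0 scale0r.
- move=> _ [s [c [us ->]]]; rewrite sndE; elim: s {us} => [|i s IH].
    by rewrite big_nil.
  by rewrite big_cons; apply: Slin.
Qed.

End Span.

(** A partial linear map that is undefined at u extends by the value 0 at u, which
    lies in every subspace S. *)
Lemma linear_graph_extend (S : set V) (G : set (U * V)) u : linear_graph S G ->
  (forall v, ~ G (u, v)) ->
  linear_graph S [set p + phi a *: ((u, 0) : U * V) | a in setT & p in G].
Proof.
move=> [[G0 Glin] Gfun Gran] udom; split; first split.
- by exists 0 => //; exists 0 => //; rewrite rmorph0 scale0r addr0.
- move=> a _ _ [b _ [p Gp <-]] [c _ [q Gq <-]].
  exists (a * b + c) => //; exists (phi a *: p + q); first exact: Glin.
  by rewrite rmorphD rmorphM scalerDl scalerDr -scalerA addrACA.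
- move=> v [a _ [[p1 p2] Gp [E1 E2]]]; have [a0|a0] := eqVneq a 0.
    move: E1 E2; rewrite a0 rmorph0 !scale0r !addr0 => p0 <-.
    by apply: Gfun; rewrite -p0.
  case: (udom (phi (- a^-1) *: p2)).
  have := Glin (- a^-1) _ _ Gp G0; rewrite addr0.
  congr (G _); congr pair => /=.
  have /eqP := E1; rewrite addr_eq0 => /eqP ->.
  rewrite scalerN rmorphN scaleNr opprK scalerA -rmorphM mulVf //.
  by rewrite rmorph1 scale1r.
- by move=> _ [a _ [p /Gran Sp <-]] /=; rewrite scaler0 addr0.
Qed.

(** Zorn's lemma on the partial linear maps extending x i |-> y i; a maximal one
    is total by [linear_graph_extend]. *)
Lemma linear_extension (S : set V) (I : eqType) (x : I -> U) (y : I -> V) :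
  subspace_over S -> (forall i, S (y i)) -> free_over phi x ->
  exists f : U -> V, [/\ forall a u v, f (phi a *: u + v) = phi a *: f u + f v,
    forall u, S (f u) & forall i, f (x i) = y i].
Proof.
move=> Ssub Sy free; have G0P := span_graphP Ssub Sy free.
set G0 := span_graph x y in G0P.
(* Sets are ordered after adjoining G0, so that the empty chain is bounded. *)
have [|A [GA maxA]] :=
    @Zorn_bigcup (U * V)%type [set A | linear_graph S (A `|` G0)].
  move=> C CP totC /=.
  have dir p q :
      (\bigcup_(X in C) X `|` G0) p -> (\bigcup_(X in C) X `|` G0) q ->
      exists2 X, linear_graph S (X `|` G0) /\
          X `|` G0 `<=` \bigcup_(X in C) X `|` G0 &
        (X `|` G0) p /\ (X `|` G0) q.
    move=> [[X CX Xp]|Gp] [[Y CY Yq]|Gq].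
    - have sub Z : C Z -> Z `|` G0 `<=` \bigcup_(X in C) X `|` G0.
        by move=> CZ; apply: setSU; exact: bigcup_sup.
      have [XY|YX] := totC _ _ CX CY.
        by exists Y; split; [exact: CP|exact: sub|left; exact: XY|left].
      by exists X; split; [exact: CP|exact: sub|left|left; exact: YX].
    - exists X; split; [exact: CP| |by left|by right].
      by apply: setSU; exact: bigcup_sup.
    - exists Y; split; [exact: CP| |by right|by left].
      by apply: setSU; exact: bigcup_sup.
    - exists set0; rewrite set0U; last by split.
      by split; [exact: G0P|move=> r; right].
  have [[G00 _] _ _] := G0P; split; first split.
  - by right.
  - move=> a p q Gp Gq; have [X [[[_ Xlin] _ _] sub] [Xp Xq]] := dir p q Gp Gq.
    by apply: sub; exact: Xlin.
  - by move=> v Gv; have [X [[_ Xf _] _] [Xv _]] := dir _ _ Gv Gv; exact: Xf.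
  - by move=> p Gp; have [X [[_ _ Xr] _] [Xp _]] := dir _ _ Gp Gp; exact: Xr.
set G := A `|` G0 in GA.
have /choice[f Gf] : forall u, exists v, G (u, v).
  move=> u; apply: contrapT => udom.
  have {}udom v : ~ G (u, v) by move=> Gv; apply: udom; exists v.
  have Bgraph := linear_graph_extend GA udom.
  set B := [set _ | _ in _ & _ in _] in Bgraph.
  have GB : G `<=` B.
    move=> p Gp; exists 0 => //; exists p => //.
    by rewrite rmorph0 scale0r addr0.
  apply: (maxA B); last first.
    by rewrite /= setUidl // => p G0p; apply: GB; right.
  split; first by move=> p Ap; apply: GB; left.
  move=> /(_ (u, 0)) BA; apply: (udom 0); left; apply: BA.
  exists 1 => //; exists 0; first by case: GA => [[]].
  by rewrite rmorph1 scale1r add0r.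
have [[_ Glin] _ Gran] := GA.
exists f; split=> [a u v|u|i].
- exact: (graph_unique GA (Gf _) (Glin _ _ _ (Gf u) (Gf v))).
- exact: (Gran _ (Gf u)).
- apply: (graph_unique GA (Gf _)); right; exists [:: i], (fun=> 1); split=> //.
  by rewrite big_seq1 rmorph1 scale1r.
Qed.

End LinearExtension.

(** * A generic additive map into the bounded sequences *)

Section GenericAdditive.
Variable R : realType.

Definition bounded_seq (y : nat -> R) : Prop := exists C, forall n, `|y n| <= C.

Lemma bounded_seq_comb (a : R) y z : bounded_seq y -> bounded_seq z ->
  bounded_seq (fun n => y n + a * z n).
Proof.
move=> [C yC] [D zD]; exists (C + `|a| * D) => n.
by rewrite (le_trans (ler_normD _ _)) // lerD // normrM ler_wpM2l.
Qed.

Lemma bounded_seq_subspace :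
  subspace_over (@ratr R) (bounded_seq : set (nat -> R^o)).
Proof.
split; first by exists 0 => n; rewrite normr0.
move=> a p q bp bq; have := bounded_seq_comb (ratr a) bq bp.
by congr bounded_seq; apply/funext => n; rewrite addrC.
Qed.

(** Each value h k is recorded by its Dedekind cut. *)
Lemma real_function_code (K : countType) :
  exists e : (K -> R) -> (nat -> bool), injective e.
Proof.
exists (fun h m => if unpickle m is Some (k, q) then ratr q < h k else false).
move=> g h gh; apply/funext => k.
have E q : (ratr q < g k) = (ratr q < h k).
  by have := congr1 (fun a => a (pickle (k, q))) gh; rewrite pickleK.
apply/eqP; case: ltgtP => // /rat_in_itvoo[q]; rewrite in_itv /= => /andP[].
- by move=> + qh; rewrite ltNge => /negP[]; rewrite ltW // E.
- by move=> + qg; rewrite ltNge => /negP[]; rewrite ltW // -E.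
Qed.

Lemma nbhs_ratr (u : R) (P : set R) : nbhs u P -> exists r : rat, P (ratr r).
Proof.
move=> /nbhs_ballP[e e0 uP]; have /rat_in_itvoo[r] : u < u + e by rewrite ltrDl.
rewrite in_itv /= => /andP[ur re]; exists r; apply: uP.
by rewrite /ball /= distrC ltr_distlC; apply/andP; split; lra.
Qed.

Lemma continuous_eq_on_rat (g h : R * R -> R) : continuous g -> continuous h ->
  (forall r s : rat, g (ratr r, ratr s) = h (ratr r, ratr s)) -> g = h.
Proof.
move=> cg ch gh; apply/funext => -[u t]; apply/eqP; rewrite -subr_eq0.
apply: contrapT => /negP; rewrite -normr_gt0 => d0.
have cd : continuous (fun z => g z - h z).
  by move=> z; apply: cvgB; [exact: cg|exact: ch].
have /cvgrPdist_lt /(_ _ d0) := cd (u, t); rewrite nearE.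
move=> [[A B] /= [/nbhs_ratr[r Ar] /nbhs_ratr[s Bs]] AB].
by have := AB (ratr r, ratr s) (conj Ar Bs); rewrite /= gh subrr subr0 ltxx.
Qed.

(** The multiplier must be nonzero for it to preserve linear independence, so
    the target interval is first shrunk to avoid 0. *)
Lemma rational_multiple_between (x a b : R) : x != 0 -> a < b ->
  exists2 r : rat, r != 0 & a < ratr r * x < b.
Proof.
wlog x0 : x a b / 0 < x.
  move=> H xn0 ab; have [x0|xle0] := ltP 0 x; first exact: H.
  have [|||r r0 /andP[l u]] := H (- x) (- b) (- a).
  - by rewrite oppr_gt0 lt_neqAle xn0.
  - by rewrite oppr_eq0.
  - by rewrite ltrN2.
  - by exists r => //; apply/andP; split; lra.
move=> _ ab.
have [c [d [acd cd db c0]]] :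
    exists c d, [/\ a <= c, c < d, d <= b & 0 \notin `]c, d[].
  have [b0|b0] := leP b 0.
    by exists a, b; split=> //; rewrite in_itv /= [0 < b]ltNge b0 andbF.
  exists (Num.max a 0), b; split=> //; rewrite ?le_max ?lexx // ?gt_max ?ab //.
  by rewrite in_itv /= gt_max ltxx andbF.
have /rat_in_itvoo[r] : c / x < d / x by rewrite ltr_pM2r ?invr_gt0.
rewrite in_itv /= => /andP[]; rewrite ltr_pdivrMr // ltr_pdivlMr // => cr rd.
exists r; last by rewrite (le_lt_trans acd cr) (lt_le_trans rd db).
apply: contraNneq c0 => r0; move: cr rd.
by rewrite r0 rmorph0 mul0r in_itv /= => -> ->.
Qed.

Lemma free_real_neq0 a : free_real R a != 0.
Proof.
apply/eqP => a0; have := @free_real_free R [:: a] (fun=> 1) isT.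
rewrite big_seq1 a0 scaler0 => /(_ erefl a); rewrite mem_head => /(_ isT) /eqP.
by rewrite oner_eq0.
Qed.

(** Each requirement (p, v, g) is met at a rational multiple of the free real
    indexed by its own code.  Distinct requirements have distinct codes, so the
    prescriptions never conflict. *)
Lemma generic_additive_function : exists f : R -> nat -> R,
  [/\ forall x y, f (x + y) = (fun n => f x n + f y n),
      forall x, bounded_seq (f x)
    & forall (p v : nat -> R) (g : R * R -> R) (a b : R),
      bounded_seq p -> bounded_seq v -> continuous g ->
      a < b -> (forall x, a < x < b -> exists t, g (x, t) = 0) ->
      exists x t, g (x, t) = 0 /\ f x = (fun n => p n + t * v n)].
Proof.
have [e einj] := real_function_code (nat + nat + rat * rat)%type.
pose code p v (g : R * R -> R) := e (fun k => match k with
  | inl (inl n) => p n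
  | inl (inr n) => v n
  | inr (q, s) => g (ratr q, ratr s) end).
pose valid (p v : nat -> R) (g : R * R -> R) :=
  [/\ bounded_seq p, bounded_seq v, continuous g
  & exists a b : R,
      a < b /\ forall x, a < x < b -> exists t, g (x, t) = 0].
have code_inj p v g p' v' g' : valid p v g -> valid p' v' g' ->
    code p v g = code p' v' g' -> [/\ p = p', v = v' & g = g'].
  move=> [_ _ cg _] [_ _ cg' _] /einj E; split.
  - by apply/funext => n; exact: (congr1 (@^~ (inl (inl n))) E).
  - by apply/funext => n; exact: (congr1 (@^~ (inl (inr n))) E).
  - apply: continuous_eq_on_rat => // r s.
    exact: (congr1 (@^~ (inr (r, s))) E).
(* For a word al, the pair gives a multiplier and the value of f prescribed at
   that multiple of the real of index al; words coding nothing get a dummy. *)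
have /choice[xy Hxy] : forall al, exists xy : rat * (nat -> R),
    [/\ xy.1 != 0, bounded_seq xy.2 & forall p v g, valid p v g ->
       code p v g = al -> exists t, g (ratr xy.1 * free_real R al, t) = 0 /\
         xy.2 = (fun n => p n + t * v n)].
  move=> al; have [[[[p v] g] [V cal]]|none] :=
    pselect (exists pvg,
      let: (p, v, g) := pvg in valid p v g /\ code p v g = al).
    have [bp bv cg [a [b [ab gt]]]] := V.
    have [r r0 /gt[t gt0]] := rational_multiple_between (free_real_neq0 al) ab.
    exists (r, fun n => p n + t * v n); split=> //.
      exact: bounded_seq_comb.
    move=> p' v' g' V'; rewrite -cal => /(code_inj _ _ _ _ _ _ V' V)[-> -> ->].
    by exists t; rewrite cal.
  exists (1, fun=> 0); split=> [||p v g V cal]; rewrite ?oner_eq0 //.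
    by exists 0 => n; rewrite normr0.
  by case: none; exists (p, v, g).
pose x al := ratr (xy al).1 * free_real R al.
have xfree : free_over (@ratr R) (x : _ -> R^o).
  move=> s c us s0 al als; have [r0 _ _] := Hxy al.
  have := @free_real_free R s (fun be => c be * (xy be).1) us.
  rewrite (eq_bigr (fun be => ratr (c be) *: (x be : R^o))).
    move=> /(_ s0 _ als)/eqP.
    by rewrite mulf_eq0 (negPf r0) orbF => /eqP.
  by move=> be _; rewrite rmorphM /= -scalerA.
have ybd al : bounded_seq (xy al).2 by have [] := Hxy al.
have [f [flin fbd fx]] := linear_extension bounded_seq_subspace ybd xfree.
exists f; split=> [y z|//|p v g a b bp bv cg ab gt].
  by have := flin 1 y z; rewrite rmorph1 !scale1r.
have V : valid p v g by split=> //; exists a, b.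
have [_ _ /(_ _ _ _ V erefl)[t [gt0 E]]] := Hxy (code p v g).
by exists (x (code p v g)), t; rewrite fx.
Qed.

End GenericAdditive.

(** * Group metrics on the real line *)

Record group_norm (R : realType) := GroupNorm {
  gnorm :> R -> R;
  gnorm0 : gnorm 0 = 0;
  gnormN : forall x, gnorm (- x) = gnorm x;
  gnormD : forall x y, gnorm (x + y) <= gnorm x + gnorm y;
  gnorm_ge : forall x, `|x| <= gnorm x }.

(** A copy of R as a type of its own, so that the metric of N does not compete
    with the usual one. *)
Definition normed_line (R : realType) (N : group_norm R) : Type := R.

Section NormedLine.
Variables (R : realType) (N : group_norm R).
Local Notation M := (normed_line N).

HB.instance Definition _ := GRing.Zmodule.copy M R.

Definition line_dist (x y : M) : R := N (y - x).

Lemma line_distxx x : line_dist x x = 0.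
Proof. by rewrite /line_dist subrr gnorm0. Qed.

Lemma line_dist_eq0 x y : line_dist x y = 0 -> x = y.
Proof.
move=> d0; have := gnorm_ge N (y - x); rewrite [N _]d0 normr_le0 subr_eq0.
by move/eqP.
Qed.

Lemma line_dist_sym x y : line_dist x y = line_dist y x.
Proof. by rewrite /line_dist -gnormN opprB. Qed.

Lemma line_dist_triangle y x z :
  line_dist x z <= line_dist x y + line_dist y z.
Proof.
rewrite /line_dist (_ : z - x = (y - x) + (z - y)); first exact: gnormD.
by rewrite [RHS]addrC addrA subrK.
Qed.

HB.instance Definition _ := isMetric.Build R M
  line_distxx line_dist_eq0 line_dist_sym line_dist_triangle.

Lemma nbhs_lineP (x : M) (P : set M) :
  nbhs x P <-> exists2 e, 0 < e & forall y, N (y - x) < e -> P y.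
Proof.
by rewrite -metricType_numDomainType.filter_from_mdist_nbhs;
  split=> -[e e0 H]; exists e.
Qed.

Lemma closure_lineP (D : set M) (x : M) :
  closure D x <-> forall e, 0 < e -> exists2 d, D d & N (x - d) < e.
Proof.
split=> [cl e e0|H B /nbhs_lineP[e e0 B_]].
  have [|d [Dd /= de]] := cl [set y | N (y - x) < e].
    by apply/nbhs_lineP; exists e.
  by exists d => //; rewrite -gnormN opprB.
have [d Dd dx] := H _ e0; exists d; split=> //; apply: B_.
by rewrite -gnormN opprB.
Qed.

Lemma line_topological_group : is_topological_group M.
Proof.
exists (fun x y => x + y), 0, (fun x => - x); split.
- split; [exact: addrA|exact: add0r|exact: addr0|exact: addNr|exact: addrN].
- move=> [x y] B /nbhs_lineP[e e0 B_] /=; rewrite /= in B_.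
  exists ([set u : M | N (u - x) < e / 2], [set v : M | N (v - y) < e / 2]).
    by split; apply/nbhs_lineP; exists (e / 2) => //; rewrite divr_gt0.
  move=> [u v] [/= ux vy]; apply: B_; rewrite opprD addrACA.
  by rewrite (le_lt_trans (gnormD _ _ _)) // [e]splitr ltrD.
- move=> x B /nbhs_lineP[e e0 B_]; apply/nbhs_lineP; exists e => // y yx.
  by apply: B_; rewrite -opprD gnormN.
Qed.

Lemma line_translation_continuous (h : M) : continuous (fun x : M => x + h).
Proof.
move=> x B /nbhs_lineP[e e0 B_]; apply/nbhs_lineP; exists e => // y yx.
by apply: B_; rewrite opprD addrACA subrr addr0.
Qed.

Lemma line_homogeneous : homogeneous_space M.
Proof.
move=> x y; exists (fun z => z + (y - x)), (fun z => z + (x - y)); split.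
- by move=> z; rewrite -(opprB y x) addrK.
- by move=> z; rewrite -(opprB x y) addrK.
- exact: line_translation_continuous.
- exact: line_translation_continuous.
- by rewrite addrC subrK.
Qed.

Lemma line_to_reals_continuous : continuous (fun x : M => (x : R)).
Proof.
move=> x B /nbhs_ballP[e e0 B_]; apply/nbhs_lineP; exists e => // y yx.
by apply: B_; rewrite /ball /= distrC (le_lt_trans (gnorm_ge N _)).
Qed.

(** The image of a connected set under the continuous identity map to R. *)
Lemma line_connected_interval (A : set M) :
  connected A -> is_interval (A : set R).
Proof.
move=> cA; apply/connected_intervalP.
rewrite -(image_id (A : set R)).
apply: (connected_continuous_connected (T := M) cA).
exact/continuous_subspaceT/line_to_reals_continuous.
Qed.

Lemma line_cut_point (p : M) : ~ connected ([set: M] `\ p).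
Proof.
move/line_connected_interval => /(_ (p - 1 : R) (p + 1 : R)) H.
have neq (d : R) : d != 0 -> ([set: M] `\ p) (p + d : R).
  move=> d0; split=> // /eqP; rewrite -subr_eq0 addrC addKr.
  exact/negP.
suff [_ /(_ erefl)] : ([set: M] `\ p) p by [].
apply: (H _ _ p); last by apply/andP; split; lra.
  by apply: neq; rewrite oppr_eq0 oner_eq0.
by apply: neq; rewrite oner_eq0.
Qed.

(** The translates of A by the multiples of b - a cover M, so the translates of
    a countable dense subset of A are dense in M. *)
Lemma separable_of_interval (A : set M) (a b : M) :
  separable_set A -> connected A -> A a -> A b -> a <> b ->
  separable_set [set: M].
Proof.
wlog : a b / (a : R) < b.
  move=> H sA cA Aa Ab anb; have [ab|ba|//] := ltgtP (a : R) b.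
    exact: (H a b).
  by apply: (H b a) => //; exact: nesym.
move=> ab [D [cD DA AD]] /line_connected_interval iA Aa Ab _.
pose shift (z : M * int) : M := z.1 + (b - a) *~ z.2.
exists (shift @` (D `*` [set: int])); split=> //.
  by apply: card_le_trans (card_image_le _ _) _; exact: countableX.
move=> x _; apply/closure_lineP => e e0.
pose k := Num.floor ((x - a : R) / (b - a)).
have ba0 : 0 < b - a :> R by rewrite subr_gt0.
have Ay : A (x - (b - a) *~ k).
  apply: (iA _ _ Aa Ab); rewrite (_ : _ - _ *~ k = (x - k%:~R * (b - a) : R)).
    have /andP[] := floor_itv ((x - a : R) / (b - a)).
    rewrite -/k ltr_pdivrMr // ler_pdivlMr // rmorphD /= mulrDl mul1r => ? ?.
    by apply/andP; split; lra.
  by rewrite mulrzl.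
have /closure_lineP /(_ _ e0)[d Dd dx] := AD _ Ay.
exists (shift (d, k)); first by exists (d, k).
by rewrite /shift /= opprD addrA addrAC.
Qed.

Lemma rationals_separable :
  (forall e, 0 < e ->
    exists2 d : R, 0 < d & forall x : R, `|x| < d -> N x < e) ->
  separable_set [set: M].
Proof.
move=> Nc; exists (range (@ratr R)); split=> //.
  exact: card_le_trans (card_image_le _ _) (countableP _).
move=> x _; apply/closure_lineP => e /Nc[d d0 dN].
have /rat_in_itvoo[r] : (x : R) < x + d by rewrite ltrDl.
rewrite in_itv /= => /andP[xr rd]; exists (ratr r); first by exists r.
by apply: dN; rewrite distrC gtr0_norm; lra.
Qed.

(** Otherwise {p} would be open and closed in a connected space with more than
    one point. *)
Lemma nbhs_not_singleton (V : set M) p : connected [set: M] -> nbhs p V ->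
  exists2 q, V q & q <> p.
Proof.
move=> cM /nbhs_lineP[e e0 Vp]; apply: contrapT => H.
have {}H q : V q -> q = p.
  by move=> Vq; apply: contrapT => ?; apply: H; exists q.
have : [set p] = [set: M].
  apply: cM; first by exists p.
    exists [set p]; rewrite ?setTI // openE => _ -> /=; apply/nbhs_lineP.
    by exists e => // y /Vp /H.
  exists [set p]; rewrite ?setTI //.
  apply: accessible_closed_set1; apply: hausdorff_accessible.
  exact: metric_hausdorff.
move/(congr1 (fun A => A (p + 1 : R))) => /= E.
have : (p + 1 : R) = p by rewrite E.
by move/eqP; rewrite -subr_eq0 addrC addKr oner_eq0.
Qed.

Lemma gnorm_abs (x : R) : N `|x| = N x.
Proof.
by have [x0|x0] := leP 0 x; rewrite ?(ger0_norm x0) // ltr0_norm ?gnormN.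
Qed.

(** A connected neighborhood of p inside the ball of radius e is an interval
    with more than one point.  It has p as an endpoint at worst, so N < e on one
    side of 0, and on both sides because N is even. *)
Lemma line_not_locally_connected (p : M) : connected [set: M] ->
  ~ separable_set [set: M] -> ~ locally_connected_at p.
Proof.
move=> cM nsep lc; apply: nsep; apply: rationals_separable => e e0.
have [|V [pV VU cV]] := lc [set y | N (y - p) < e].
  by apply/nbhs_lineP; exists e.
have [q Vq qp] := nbhs_not_singleton cM pV.
have Vp : V p := nbhs_singleton pV.
have iV := line_connected_interval cV.
exists `|(q - p : R)|; first by rewrite normr_gt0 subr_eq0; exact/eqP.
have [pq|pq|pq] := ltgtP (p : R) q; last by case: qp; rewrite pq.
  rewrite gtr0_norm ?subr_gt0 // => x xd.
  rewrite -gnorm_abs.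
  suff /VU : V (p + `|x| : R) by rewrite /= [p + _]addrC addrK.
  by apply: (iV _ _ Vp Vq); apply/andP; split; have := normr_ge0 x; lra.
rewrite ltr0_norm ?subr_lt0 // => x xd.
rewrite -gnorm_abs -gnormN.
suff /VU : V (p - `|x| : R) by rewrite /= [p - _]addrC addrK.
by apply: (iV _ _ Vq Vp); apply/andP; split; have := normr_ge0 x; lra.
Qed.

(** This isolates what the choice of N has to achieve: being a group under a
    norm above the absolute value yields the rest. *)
Lemma connected_nonseparable_line : connected [set: M] ->
  ~ separable_set [set: M] ->
  [/\ nonseparably_connected M,
        [set: M] #= [set: R],
        forall p : M, ~ connected ([set: M] `\ p),
        forall p : M, ~ locally_connected_at p
      & is_topological_group M /\ homogeneous_space M].
Proof.
move=> cM nsep; split.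
- split=> // A [a Aa] sA cA; exists a; apply/seteqP; split=> [b Ab|_ ->//].
  apply: contrapT => ba; apply: nsep.
  exact: (separable_of_interval sA cA Ab Aa).
- exact: card_eqxx.
- exact: line_cut_point.
- by move=> p; exact: line_not_locally_connected.
- by split; [exact: line_topological_group|exact: line_homogeneous].
Qed.

End NormedLine.

(** * The graph of a generic additive map *)

Section SupNorm.
Variable R : realType.
Implicit Types y z : nat -> R.

Definition sup_norm y : R := sup (range (fun n => `|y n|)).

Lemma ler_sup_norm y n : bounded_seq y -> `|y n| <= sup_norm y.
Proof.
move=> [C yC]; apply: ub_le_sup; last by exists n.
by exists C => _ [m _ <-].
Qed.

Lemma sup_norm_le y C : (forall n, `|y n| <= C) -> sup_norm y <= C.
Proof.
by move=> yC; apply: ge_sup; [exists `|y 0%N|, 0%N|move=> _ [m _ <-]].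
Qed.

Lemma sup_norm_ge0 y : bounded_seq y -> 0 <= sup_norm y.
Proof.
by move=> by_; rewrite (le_trans (normr_ge0 (y 0%N))) // ler_sup_norm.
Qed.

Lemma sup_norm_comb (a : R) y z : bounded_seq y -> bounded_seq z ->
  sup_norm (fun n => y n + a * z n) <= sup_norm y + `|a| * sup_norm z.
Proof.
move=> by_ bz; apply: sup_norm_le => n; rewrite (le_trans (ler_normD _ _)) //.
by rewrite lerD ?ler_sup_norm // normrM ler_wpM2l // ler_sup_norm.
Qed.

Lemma sup_norm_triangle y z w :
  bounded_seq (fun n => y n - z n) -> bounded_seq (fun n => z n - w n) ->
  sup_norm (fun n => y n - w n) <=
    sup_norm (fun n => y n - z n) + sup_norm (fun n => z n - w n).
Proof.
move=> b1 b2; have := sup_norm_comb 1 b1 b2; rewrite normr1 mul1r.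
by under [in X in X <= _]eq_fun do rewrite mul1r addrA subrK.
Qed.

Lemma bounded_seqB y z : bounded_seq y -> bounded_seq z ->
  bounded_seq (fun n => y n - z n).
Proof.
move=> b1 b2; have := bounded_seq_comb (-1) b1 b2.
by under eq_fun do rewrite mulN1r.
Qed.

End SupNorm.

Section GraphMetric.
Variables (R : realType) (f : R -> nat -> R).
Hypothesis fD : forall x y, f (x + y) = (fun n => f x n + f y n).
Hypothesis fbd : forall x, bounded_seq (f x).

Let f0 : f 0 = (fun=> 0).
Proof.
apply/funext => n; have := congr1 (@^~ n) (fD 0 0); rewrite addr0 /=.
by move/eqP; rewrite -subr_eq0 opprD addrA subrr sub0r oppr_eq0 => /eqP.
Qed.

Let fN x : f (- x) = (fun n => - f x n).
Proof.
apply/funext => n; have := congr1 (@^~ n) (fD x (- x)); rewrite subrr f0 /=.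
by move/esym/eqP; rewrite addrC addr_eq0 => /eqP.
Qed.

Let fB x y : f (x - y) = (fun n => f x n - f y n).
Proof. by rewrite fD fN. Qed.

Definition graph_norm_fun x := `|x| + sup_norm (f x).

Let graph_norm0 : graph_norm_fun 0 = 0.
Proof.
apply/eqP; rewrite eq_le addr_ge0 ?sup_norm_ge0 // andbT.
rewrite /graph_norm_fun normr0 add0r.
by apply: sup_norm_le => n; rewrite f0 normr0.
Qed.

Let graph_normN x : graph_norm_fun (- x) = graph_norm_fun x.
Proof.
rewrite /graph_norm_fun normrN fN /sup_norm.
by under [X in sup (range X)]eq_fun do rewrite normrN.
Qed.

Let graph_normD x y :
  graph_norm_fun (x + y) <= graph_norm_fun x + graph_norm_fun y.
Proof.
rewrite /graph_norm_fun addrACA lerD ?ler_normD // fD.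
have := sup_norm_comb 1 (fbd x) (fbd y); rewrite normr1 mul1r.
by under [in X in X <= _]eq_fun do rewrite mul1r.
Qed.

Let graph_norm_ge x : `|x| <= graph_norm_fun x.
Proof. by rewrite lerDl sup_norm_ge0. Qed.

Definition graph_norm : group_norm R :=
  GroupNorm graph_norm0 graph_normN graph_normD graph_norm_ge.

Hypothesis f_generic : forall (p v : nat -> R) (g : R * R -> R) (a b : R),
  bounded_seq p -> bounded_seq v -> continuous g ->
  a < b -> (forall x, a < x < b -> exists t, g (x, t) = 0) ->
  exists x t, g (x, t) = 0 /\ f x = (fun n => p n + t * v n).

Local Notation M := (normed_line graph_norm).

(** Genericity for the constant line at y, with no condition on x. *)
Lemma f_surjective y : bounded_seq y -> exists x, f x = y.
Proof.
move=> by_; have b0 : bounded_seq (fun=> 0 : R).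
  by exists 0 => n; rewrite normr0.
have [|||x [t [_ fx]]] := @f_generic y (fun=> 0) (cst 0) 0 1 by_ b0.
- by move=> z; exact: cvg_cst.
- exact: ltr01.
- by move=> x _; exists 0.
by exists x; rewrite fx; apply/funext => n; rewrite mulr0 addr0.
Qed.

(** Cantor's diagonal: the sequence y is at distance at least 1 from f d, at the
    coordinate numbered by d, for each d in a countable set D; but y is a value
    of f. *)
Lemma graph_line_nonseparable : ~ separable_set [set: M].
Proof.
move=> [D [/countable_injP[e einj] _ dense]].
have /choice[y Hy] : forall m, exists r : R, `|r| <= 1 /\
    forall d, D d -> e d = m -> 1 <= `|r - f d m|.
  move=> m; have [[d [Dd edm]]|none] :=
    pselect (exists d, D d /\ e d = m); last first.
    by exists 0; rewrite normr0; split=> // d Dd edm; case: none; exists d.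
  exists (if 0 <= f d m then -1 else 1); split.
    by case: ifP; rewrite ?normrN normr1.
  move=> d' Dd' ed'm; have -> : d' = d by apply: einj; rewrite ?inE ?ed'm.
  case: (leP 0 (f d m)) => h; last by rewrite gtr0_norm; lra.
  by rewrite -opprD normrN ger0_norm; lra.
have [|x fx] := @f_surjective y; first by exists 1 => m; case: (Hy m).
have /closure_lineP /(_ _ ltr01)[d Dd] := dense x I.
rewrite ltNge => /negP[]; rewrite /= /graph_norm_fun fB fx.
have [_ /(_ _ Dd erefl) h] := Hy (e d); rewrite (le_trans h) //.
rewrite (le_trans (@ler_sup_norm _ (fun n => y n - f d n) (e d) _)) ?lerDr //.
by rewrite -fx; exact: bounded_seqB.
Qed.

(** Distance from (u, y) to the part of the graph of f above E.  It is defined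
    off the graph as well, which is what allows moving along segments of
    sequences. *)
Definition dist_to_graph (E : set R) (u : R) (y : nat -> R) : R :=
  inf [set `|u - a| + sup_norm (fun n => y n - f a n) | a in E].

Lemma dist_to_graph_le E u y a : bounded_seq y -> E a ->
  dist_to_graph E u y <= `|u - a| + sup_norm (fun n => y n - f a n).
Proof.
move=> by_ Ea; apply: ge_inf; last by exists a.
exists 0 => _ [b _ <-]; rewrite addr_ge0 // sup_norm_ge0 //.
exact: bounded_seqB.
Qed.

Lemma dist_to_graph_lipschitz E u w y z : E !=set0 ->
  bounded_seq y -> bounded_seq z -> dist_to_graph E u y <=
    dist_to_graph E w z + (`|u - w| + sup_norm (fun n => y n - z n)).
Proof.
move=> [c Ec] by_ bz; rewrite -lerBlDr; apply: lb_le_inf.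
  by exists (`|w - c| + sup_norm (fun n => z n - f c n)), c.
move=> _ [a Ea <-]; rewrite lerBlDr (le_trans (dist_to_graph_le u by_ Ea)) //.
rewrite addrACA lerD //; first by rewrite addrC ler_distD.
by rewrite addrC; apply: sup_norm_triangle; exact: bounded_seqB.
Qed.

Lemma dist_to_graph_in E u : E u -> dist_to_graph E u (f u) <= 0.
Proof.
move=> Eu; rewrite (le_trans (dist_to_graph_le u (fbd u) Eu)) //.
rewrite subrr normr0 add0r.
by apply: sup_norm_le => n; rewrite subrr normr0.
Qed.

Lemma dist_to_graph_gt0 (E : set M) (u : M) : E !=set0 -> ~ closure E u ->
  0 < dist_to_graph E u (f u).
Proof.
move=> [c Ec] nEu; rewrite ltNge; apply/negP => d0; apply: nEu.
apply/closure_lineP => e e0.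
have [|_ [a Ea <-]] := @inf_adherent _
  [set `|(u : R) - a| + sup_norm (fun n => f u n - f a n) | a in E] _ e0.
  split.
    by exists (`|(u : R) - c| + sup_norm (fun n => f u n - f c n)), c.
  exists 0 => _ [b _ <-]; rewrite addr_ge0 // sup_norm_ge0 //.
  exact: bounded_seqB.
move=> h; exists a => //; rewrite /= /graph_norm_fun fB (lt_le_trans h) //.
by rewrite -[leRHS]add0r lerD2r.
Qed.

(** The function g is positive or negative on the graph according to the piece
    of the separation.  It changes sign on a segment {u} x [p, q] for all u near
    some u0, and genericity of f produces a point of the graph where it
    vanishes. *)
Lemma graph_line_connected : connected [set: M].
Proof.
apply/connectedP => E [E0 ET [sep1 sep2]].
pose g u y := dist_to_graph (E false) u y - dist_to_graph (E true) u y.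
have gE0 (u : M) : E false u -> g u (f u) < 0.
  move=> Eu; have := dist_to_graph_in Eu.
  have : 0 < dist_to_graph (E true) u (f u).
    apply: dist_to_graph_gt0 => // cEu.
    by have : (E false `&` closure (E true)) u by []; rewrite sep2.
  by rewrite /g; lra.
have gE1 (u : M) : E true u -> 0 < g u (f u).
  move=> Eu; have := dist_to_graph_in Eu.
  have : 0 < dist_to_graph (E false) u (f u).
    apply: dist_to_graph_gt0 => // cEu.
    by have : (closure (E false) `&` E true) u by []; rewrite sep1.
  by rewrite /g; lra.
have g_lip u w y z : bounded_seq y -> bounded_seq z ->
    `|g u y - g w z| <= 2 * (`|u - w| + sup_norm (fun n => y n - z n)).
  move=> by_ bz.
  have := dist_to_graph_lipschitz u w (E0 false) by_ bz.
  have := dist_to_graph_lipschitz u w (E0 true) by_ bz.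
  have := dist_to_graph_lipschitz w u (E0 false) bz by_.
  have := dist_to_graph_lipschitz w u (E0 true) bz by_.
  have -> : sup_norm (fun n => z n - y n) = sup_norm (fun n => y n - z n).
    by rewrite /sup_norm; under eq_fun do rewrite distrC.
  by rewrite /g ler_norml (distrC w u) => ? ? ? ?; apply/andP; split; lra.
pose P0 : set R := [set u | exists2 y, bounded_seq y & g u y < 0].
pose P1 : set R := [set u | exists2 y, bounded_seq y & 0 < g u y].
have near_g u y : bounded_seq y -> g u y != 0 ->
    exists2 d, 0 < d & forall w, `|w - u| < d -> `|g w y - g u y| < `|g u y|.
  move=> by_ gn0; exists (`|g u y| / 2); first by rewrite divr_gt0 ?normr_gt0.
  move=> w wu; rewrite (le_lt_trans (g_lip _ _ _ _ by_ by_)) //.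
  have : sup_norm (fun n => y n - y n) <= 0.
    by apply: sup_norm_le => n; rewrite subrr normr0.
  by lra.
(* P0 and P1 are open and cover R, since the graph has a point above each u. *)
have [u0 [[p bp gp] [q bq gq]]] : exists u, P0 u /\ P1 u.
  have openP (P : R -> bool) :
      (forall r s : R, P r -> `|s - r| < `|r| -> P s) ->
      (forall r, P r -> r != 0) ->
      open [set u : R | exists2 y, bounded_seq y & P (g u y)].
    move=> Pnear Pneq0; rewrite openE => u [y by_ Pg].
    have [d d0 Hd] := near_g u y by_ (Pneq0 _ Pg).
    apply/nbhs_ballP; exists d => // w; rewrite /ball /= distrC => /Hd gw.
    by exists y => //; exact: Pnear Pg gw.
  have P0open : open P0.
    apply: (openP (fun r => r < 0)) => [r s r0|r r0]; last by rewrite lt_eqF.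
    by rewrite (ltr0_norm r0) ltr_norml; lra.
  have P1open : open P1.
    apply: (openP (fun r => 0 < r)) => [r s r0|r r0]; last by rewrite gt_eqF.
    by rewrite (gtr0_norm r0) ltr_norml; lra.
  have sub0 (u : R) : E false u -> P0 u by move=> /gE0; exists (f u).
  have sub1 (u : R) : E true u -> P1 u by move=> /gE1; exists (f u).
  apply: contrapT => disj.
  have P0C : P0 = ~` P1.
    apply/seteqP; split=> [u u0 u1|u nu]; first by apply: disj; exists u.
    have : (E false `|` E true) u by rewrite -ET.
    by case=> [/sub0//|/sub1].
  have Rconn : connected [set: R] by apply/connected_intervalP.
  have P0T : P0 = [set: R].
    apply: Rconn.
    - by have [u /sub0 ?] := E0 false; exists u.
    - by exists P0; rewrite ?setTI.
    - by exists P0; rewrite ?setTI // P0C; exact: open_closedC.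
  have [u /sub1 u1] := E0 true; apply: disj; exists u; split=> //.
  by rewrite P0T.
pose v n := q n - p n; have bv : bounded_seq v by exact: bounded_seqB.
pose h (z : R * R) := g z.1 (fun n => p n + z.2 * v n).
have h_lip u w s t :
    `|h (u, s) - h (w, t)| <= 2 * (`|u - w| + `|s - t| * sup_norm v).
  have bs (r : R) := bounded_seq_comb r bp bv.
  rewrite (le_trans (g_lip _ _ _ _ (bs s) (bs t))) // ler_pM2l // lerD2l.
  apply: sup_norm_le => n.
  rewrite opprD addrACA subrr add0r -mulrBl.
  by rewrite normrM ler_wpM2l // ler_sup_norm.
have nv0 : 0 <= sup_norm v by exact: sup_norm_ge0.
have hc : continuous h.
  move=> [u s]; apply/cvgrPdist_lt => e e0.
  pose d := e / (2 * (1 + sup_norm v)).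
  have n0 : 0 < 1 + sup_norm v by lra.
  have d0 : 0 < d by rewrite divr_gt0 // mulr_gt0.
  have dE : 2 * (d + d * sup_norm v) = e.
    by rewrite /d; field; exact: lt0r_neq0.
  exists (ball (u : R) d, ball (s : R) d); first by split; exact: nbhsx_ballx.
  move=> [w t] [/= wd td]; rewrite (le_lt_trans (h_lip _ _ _ _)) // -dE.
  by rewrite ltr_pM2l // ltr_leD // ler_wpM2r // ltW.
have h0 u : h (u, 0) = g u p.
  by rewrite /h /=; under eq_fun do rewrite mul0r addr0.
have h1 u : h (u, 1) = g u q.
  by rewrite /h /v /=; under eq_fun do rewrite mul1r addrC subrK.
have [|dp dp0 Hp] := near_g u0 p bp; first by rewrite lt_eqF.
have [|dq dq0 Hq] := near_g u0 q bq; first by rewrite gt_eqF.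
pose d := Num.min dp dq; have d0 : 0 < d by rewrite lt_min dp0.
have [||x [t [hxt fx]]] := f_generic bp bv hc (_ : u0 - d < u0 + d).
- by lra.
- move=> x xd; have : `|x - u0| < d by rewrite ltr_distl.
  rewrite lt_min => /andP[/Hp + /Hq].
  rewrite (ltr0_norm gp) (gtr0_norm gq) !ltr_norml.
  move=> /andP[_ hp] /andP[hq _].
  have [||t _ ht] := @IVT R (fun t => h (x, t)) 0 1 0 ler01.
  + apply: continuous_subspaceT => t.
    apply: (@continuous_comp _ _ _ (fun t : R => (x, t)) h); last exact: hc.
    apply: (@cvg_pair _ _ _ _ (nbhs (x : R)) (nbhs (t : R))).
      exact: cvg_cst.
    exact: cvg_id.
  + rewrite ge_min le_max h0 h1.
    by apply/andP; split; apply/orP; [left|right]; lra.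
  by exists t.
have gx0 : g x (f x) = 0 by rewrite fx.
have : (E false `|` E true) x by rewrite -ET.
by case=> [/gE0|/gE1]; rewrite gx0 ltxx.
Qed.

End GraphMetric.

Theorem theorem6 (R : realType) :
  exists M : metricType R,
    [/\ nonseparably_connected M,
        [set: M] #= [set: R],
        forall p : M, ~ connected ([set: M] `\ p),
        forall p : M, ~ locally_connected_at p
      & is_topological_group M /\ homogeneous_space M].
Proof.
have [f [fD fbd f_generic]] := generic_additive_function R.
exists (normed_line (graph_norm fD fbd)).
apply: connected_nonseparable_line.
- exact: graph_line_connected.
- exact: graph_line_nonseparable.
Qed.
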